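(* For every integer $n\ge2$ and every real $p\in(1,+\infty)$, $$\frac1n\, e^{\frac{(p-1)n}{p}}\Big(\frac{(p-1)n}{p}\Big)^{\frac np}\Gamma\Big(1-\frac np,\frac{(p-1)n}{p}\Big)>\frac{p-1}{pn}.$$
   Context: $\Gamma(s,x)=\int_x^{+\infty}t^{s-1}e^{-t}\,dt$ ($s\in\mathbb{R}$, $x>0$) is the upper incomplete gamma function. *)

(* Defs.v *)
From Stdlib Require Import Reals.
From Coquelicot Require Import Coquelicot.
Open Scope R_scope.

(* Upper incomplete gamma function, as an improper Riemann integral.
   Meaningful for 0 < x, where the integral converges for every real s;
   [Rpower t y] is the real power only for 0 < t, which holds on [x, +oo). *)
Definition Gamma_upper (s x : R) : R :=
  RInt_gen (fun t : R => Rpower t (s - 1) * exp (- t))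
           (at_point x) (Rbar_locally p_infty).

(* Main.v *)
Require Import Defs.
From Stdlib Require Import Reals Lra Lia.
From Coquelicot Require Import Coquelicot.
Open Scope R_scope.

(** Put [a = n/p] and [x = (p-1)n/p], so that [x + a = n] and the claim reads
    [integral_x^oo t^(-a) e^(-t) dt > g x] with [g t = t^(1-a) e^(-t) / (t+a)].
    The function [g] is an almost exact antiderivative, up to sign:
    [- g' t = t^(-a) e^(-t) (1 - a / (t+a)^2)], which is strictly below the
    integrand, and [g] vanishes at infinity.  Integrating the inequality
    [- g' < t^(-a) e^(-t)] over the half-line gives the bound
    ([gamma_integral_gt_minorant], [gamma_integral_total_gt]).

    Convergence of the improper integral, without which [RInt_gen] carries no
    information, holds because the integrals over [[x, T]] increase with [T]
    and are bounded by comparison with a multiple of [e^(-t)]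
    ([gamma_integral_le], [increasing_bounded_is_lim]). *)

(** * Improper integrals as limits *)

Lemma is_RInt_gen_of_is_lim (f F : R -> R) (x l : R) :
  (forall T, x < T -> is_RInt f x T (F T)) ->
  is_lim F p_infty l ->
  is_RInt_gen f (at_point x) (Rbar_locally p_infty) l.
Proof.
  intros HF Hlim P HP.
  destruct (Hlim P HP) as [M HM].
  exists (fun y => y = x) (fun T => Rmax M x < T).
  - reflexivity.
  - now exists (Rmax M x).
  - intros y T -> HT; simpl.
    pose proof (Rmax_l M x); pose proof (Rmax_r M x).
    exists (F T); split; [apply HF | apply HM]; lra.
Qed.

Lemma increasing_bounded_is_lim (F : R -> R) (x M : R) :
  (forall S T, x <= S <= T -> F S <= F T) ->
  (forall T, x <= T -> F T <= M) ->
  exists l : R, is_lim F p_infty l.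
Proof.
  intros Hinc Hbd.
  destruct (completeness (fun y => exists T, x <= T /\ y = F T)) as [l [Hub Hlub]].
  - exists M; intros y [T [HT ->]]; now apply Hbd.
  - exists (F x), x; split; [lra | reflexivity].
  - exists l; apply is_lim_spec; intros eps; simpl.
    destruct (Classical_Prop.classic (exists S, x <= S /\ l - eps < F S))
      as [[S [HS HFS]] | Hno].
    + exists S; intros T HT.
      assert (F T <= l) by (apply Hub; exists T; split; [lra | reflexivity]).
      assert (F S <= F T) by (apply Hinc; lra).
      apply Rabs_def1; pose proof (cond_pos eps); lra.
    + exfalso.
      assert (l <= l - eps).
      { apply Hlub; intros y [T [HT ->]].
        apply Rnot_lt_le; intros HFT; apply Hno; now exists T. }
      pose proof (cond_pos eps); lra.
Qed.

(** * The integrand and its minorant *)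

Definition gamma_integrand (a t : R) : R := Rpower t (- a) * exp (- t).

(** Equal to [t^(1-a) e^(-t) / (t+a)] for [t > 0]; factoring out the integrand
    lets the comparison with it be made on rational functions alone. *)
Definition gamma_minorant (a t : R) : R := gamma_integrand a t * (t / (t + a)).

Lemma gamma_integrand_pos (a t : R) : 0 < gamma_integrand a t.
Proof. apply Rmult_lt_0_compat; apply exp_pos. Qed.

Lemma is_derive_gamma_integrand (a t : R) :
  0 < t ->
  is_derive (gamma_integrand a) t (- (gamma_integrand a t * (1 + a / t))).
Proof.
  intros Ht; unfold gamma_integrand, Rpower.
  auto_derive; [assumption | field; lra].
Qed.

Lemma continuous_gamma_integrand (a t : R) :
  0 < t -> continuous (gamma_integrand a) t.
Proof.
  intros Ht; apply (ex_derive_continuous (gamma_integrand a)).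
  eexists; now apply is_derive_gamma_integrand.
Qed.

Lemma is_derive_gamma_minorant (a t : R) :
  0 < a -> 0 < t ->
  is_derive (gamma_minorant a) t
    (- (gamma_integrand a t * (1 - a / (t + a) ^ 2))).
Proof.
  intros Ha Ht; unfold gamma_minorant, gamma_integrand, Rpower.
  auto_derive; [split; [assumption | lra] | field; lra].
Qed.

Lemma ex_RInt_gamma_integrand (a x T : R) :
  0 < x -> x <= T -> ex_RInt (gamma_integrand a) x T.
Proof.
  intros Hx HT; apply (ex_RInt_continuous (gamma_integrand a)).
  rewrite Rmin_left, Rmax_right by lra.
  intros t Ht; apply continuous_gamma_integrand; lra.
Qed.

Lemma RInt_gamma_integrand_Chasles (a x y z : R) :
  0 < x -> x <= y <= z ->
  RInt (gamma_integrand a) x z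
    = RInt (gamma_integrand a) x y + RInt (gamma_integrand a) y z.
Proof.
  intros Hx Hy; symmetry.
  apply (RInt_Chasles (gamma_integrand a)); apply ex_RInt_gamma_integrand; lra.
Qed.

Lemma gamma_integral_gt_minorant (a x T : R) :
  0 < a -> 0 < x -> x < T ->
  gamma_minorant a x - gamma_minorant a T < RInt (gamma_integrand a) x T.
Proof.
  intros Ha Hx HT.
  set (d := fun t => gamma_integrand a t * (1 - a / (t + a) ^ 2)).
  assert (Hcont : forall t, 0 < t -> continuous d t).
  { intros t Ht; apply (ex_derive_continuous d).
    apply (ex_derive_mult (gamma_integrand a)).
    - eexists; now apply is_derive_gamma_integrand.
    - auto_derive; apply Rmult_integral_contrapositive_currified; lra. }
  assert (Hint : RInt d x T = gamma_minorant a x - gamma_minorant a T).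
  { apply is_RInt_unique.
    replace (gamma_minorant a x - gamma_minorant a T)
      with (minus (- gamma_minorant a T) (- gamma_minorant a x))
      by (unfold minus, plus, opp; simpl; ring).
    apply (is_RInt_derive (fun t => - gamma_minorant a t) d);
      rewrite Rmin_left, Rmax_right by lra; intros t Ht.
    - rewrite <- (Ropp_involutive (d t)).
      apply (is_derive_opp (gamma_minorant a)).
      apply is_derive_gamma_minorant; lra.
    - apply Hcont; lra. }
  rewrite <- Hint; apply RInt_lt; [assumption | | |].
  - intros t Ht; apply continuous_gamma_integrand; lra.
  - intros t Ht; apply Hcont; lra.
  - intros t Ht; unfold d.
    pose proof (gamma_integrand_pos a t).
    assert (0 < a / (t + a) ^ 2)
      by (apply Rdiv_lt_0_compat; [lra | apply pow_lt; lra]).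
    nra.
Qed.

Lemma gamma_integrand_le_exp (a x t : R) :
  0 < a -> 0 < x -> x <= t ->
  gamma_integrand a t <= Rpower x (- a) * exp (- t).
Proof.
  intros Ha Hx Ht; apply Rmult_le_compat_r; [left; apply exp_pos |].
  rewrite !Rpower_Ropp; apply Rinv_le_contravar; [apply exp_pos |].
  apply Rle_Rpower_l; lra.
Qed.

Lemma gamma_integral_le (a x T : R) :
  0 < a -> 0 < x -> x <= T ->
  RInt (gamma_integrand a) x T <= Rpower x (- a) * exp (- x).
Proof.
  intros Ha Hx HT.
  set (C := Rpower x (- a)).
  assert (HC : 0 < C) by apply exp_pos.
  assert (Hint : is_RInt (fun t => C * exp (- t)) x T
                   (C * exp (- x) - C * exp (- T))).
  { replace (C * exp (- x) - C * exp (- T))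
      with (minus (- (C * exp (- T))) (- (C * exp (- x))))
      by (unfold minus, plus, opp; simpl; ring).
    apply (is_RInt_derive (fun t => - (C * exp (- t))) (fun t => C * exp (- t))).
    - intros t _; auto_derive; [trivial | ring].
    - intros t _; apply (ex_derive_continuous (fun t => C * exp (- t))).
      auto_derive; trivial. }
  apply Rle_trans with (RInt (fun t => C * exp (- t)) x T).
  - apply RInt_le; [assumption | now apply ex_RInt_gamma_integrand | |].
    + eexists; exact Hint.
    + intros t Ht; apply gamma_integrand_le_exp; lra.
  - rewrite (is_RInt_unique _ _ _ _ Hint).
    pose proof (exp_pos (- T)); nra.
Qed.

Lemma is_lim_gamma_minorant (a : R) :
  0 < a -> is_lim (gamma_minorant a) p_infty 0.
Proof.
  intros Ha.
  apply (is_lim_le_le_loc (fun _ => 0) (fun t => Rpower 1 (- a) * exp (- t))).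
  - exists 1; intros t Ht; unfold gamma_minorant.
    pose proof (gamma_integrand_pos a t).
    assert (0 < t / (t + a)) by (apply Rdiv_lt_0_compat; lra).
    assert (t / (t + a) <= 1) by (apply Rle_div_l; lra).
    assert (gamma_integrand a t <= Rpower 1 (- a) * exp (- t))
      by (apply gamma_integrand_le_exp; lra).
    nra.
  - apply is_lim_const.
  - replace (Finite 0) with (Rbar_mult (Rpower 1 (- a)) 0)
      by (simpl; f_equal; ring).
    apply is_lim_scal_l.
    apply (is_lim_comp exp Ropp p_infty 0 m_infty).
    + apply is_lim_exp_m.
    + apply (is_lim_opp (fun t => t) p_infty p_infty), is_lim_id.
    + exists 0; intros t _; discriminate.
Qed.

(** * The bound on the improper integral *)

Lemma gamma_integral_converges (a x : R) :
  0 < a -> 0 < x ->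
  exists l : R, is_lim (RInt (gamma_integrand a) x) p_infty l.
Proof.
  intros Ha Hx.
  apply (increasing_bounded_is_lim _ x (Rpower x (- a) * exp (- x))).
  - intros S T HST.
    rewrite (RInt_gamma_integrand_Chasles a x S T) by lra.
    assert (0 <= RInt (gamma_integrand a) S T); [| lra].
    apply RInt_ge_0; [lra | apply ex_RInt_gamma_integrand; lra |].
    intros t _; left; apply gamma_integrand_pos.
  - intros T HT; now apply gamma_integral_le.
Qed.

(** Passing to the limit in [gamma_integral_gt_minorant] would only give a weak
    inequality.  The strict one is therefore spent on [[x, x+1]], and the limit
    is taken on the remaining half-line. *)
Lemma gamma_integral_total_gt (a x l : R) :
  0 < a -> 0 < x ->
  is_lim (RInt (gamma_integrand a) x) p_infty l ->
  gamma_minorant a x < l.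
Proof.
  intros Ha Hx Hl.
  pose proof (gamma_integral_gt_minorant a x (x + 1) Ha Hx ltac:(lra)) as Hstrict.
  set (c := RInt (gamma_integrand a) x (x + 1) + gamma_minorant a (x + 1)).
  assert (Hc : is_lim (fun T => c - gamma_minorant a T) p_infty (c - 0)).
  { apply is_lim_minus'; [apply is_lim_const | now apply is_lim_gamma_minorant]. }
  assert (Hle : Rbar_le (c - 0) l).
  { refine (is_lim_le_loc _ _ p_infty _ _ _ Hc Hl).
    exists (x + 1); intros T HT.
    rewrite (RInt_gamma_integrand_Chasles a x (x + 1) T) by lra.
    pose proof (gamma_integral_gt_minorant a (x + 1) T Ha ltac:(lra) HT).
    unfold c; lra. }
  simpl in Hle; unfold c in Hle; lra.
Qed.

Lemma Gamma_upper_gt_minorant (a x : R) :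
  0 < a -> 0 < x -> gamma_minorant a x < Gamma_upper (1 - a) x.
Proof.
  intros Ha Hx.
  destruct (gamma_integral_converges a x Ha Hx) as [l Hl].
  replace (Gamma_upper (1 - a) x) with l;
    [now apply gamma_integral_total_gt |].
  symmetry; unfold Gamma_upper.
  replace (1 - a - 1) with (- a) by ring.
  apply is_RInt_gen_unique.
  apply (is_RInt_gen_of_is_lim _ (RInt (gamma_integrand a) x)); [| exact Hl].
  intros T HT; apply (RInt_correct (gamma_integrand a)).
  apply ex_RInt_gamma_integrand; lra.
Qed.

Theorem mainTheorem5 (n : nat) (p : R) (hn : (2 <= n)%nat) (hp : 1 < p) :
  1 / INR n
    * exp ((p - 1) * INR n / p)
    * Rpower ((p - 1) * INR n / p) (INR n / p)
    * Gamma_upper (1 - INR n / p) ((p - 1) * INR n / p)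
  > (p - 1) / (p * INR n).
Proof.
  assert (Hn : 0 < INR n) by (apply lt_0_INR; lia).
  set (a := INR n / p); set (x := (p - 1) * INR n / p).
  assert (Ha : 0 < a) by (apply Rdiv_lt_0_compat; lra).
  assert (Hx : 0 < x) by (apply Rdiv_lt_0_compat; nra).
  assert (Hq : x / (x + a) = (p - 1) / p).
  { unfold x, a; field; split; [lra | nra]. }
  assert (HK : 0 < 1 / INR n * exp x * Rpower x a).
  { repeat apply Rmult_lt_0_compat; try apply exp_pos;
      [lra | now apply Rinv_0_lt_compat]. }
  apply Rlt_gt.
  replace ((p - 1) / (p * INR n))
    with (1 / INR n * exp x * Rpower x a * gamma_minorant a x).
  - apply Rmult_lt_compat_l; [exact HK | now apply Gamma_upper_gt_minorant].
  - unfold gamma_minorant, gamma_integrand.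
    rewrite Hq, Rpower_Ropp, exp_Ropp; field.
    pose proof (exp_pos x); pose proof (exp_pos (a * ln x)).
    unfold Rpower; repeat split; lra.
Qed.
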